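(* Let $r\ge 2$ be an integer and let $f:X\to Y$ be a map between path-connected spaces. Then: 1. $TC_r(f)\le\min\{TC_r(X),TC_r(Y)\}$; 2. $\mathrm{cat}(f^{r-1})\le TC_r(f)\le\mathrm{cat}(f^{r})$.
   Context: For $n\ge1$, $f^n=f\times\cdots\times f:X^n\to Y^n$. $PY$ is the space of paths $[0,1]\to Y$. A sequential $f$-motion planner on $Z\subset X^r$ is a continuous map $f_Z:Z\to PY$ with $f_Z(x_0,\dots,x_{r-1})\left(\frac{j}{r-1}\right)=f(x_j)$ for all $j=0,\dots,r-1$. $TC_r(f)$ is the minimal $k$ such that $X^r$ is covered by $k+1$ open sets each admitting a sequential $f$-motion planner ($\infty$ if no such $k$ exists). For a path-connected space $X$, $TC_r(X):=TC_r(\mathrm{id}_X)$ is the sequential topological complexity of $X$. The LS-category $\mathrm{cat}(h)$ of a map $h:A\to B$ is the minimal $k$ such that $A$ is covered by $k+1$ open sets $U_0,\dots,U_k$ with each restriction $h|_{U_i}:U_i\to B$ nullhomotopic. *)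

(* Defs.v *)
From HB Require Import structures.
From mathcomp Require Import all_boot all_order all_algebra.
From mathcomp Require Import all_classical all_reals all_analysis homotopy.

Set Implicit Arguments.
Unset Strict Implicit.
Unset Printing Implicit Defensive.

Import Order.TTheory GRing.Theory Num.Theory.
Import numFieldNormedType.Exports.
Local Open Scope classical_set_scope.
Local Open Scope ring_scope.

Definition unit_interval (R : realType) : Type := set_type `[0 : R, 1 : R].

HB.instance Definition _ (R : realType) := Topological.on (unit_interval R).

Lemma mem_unit_interval (R : realType) (t : R) :
  0 <= t <= 1 -> t \in `[0 : R, 1 : R]%classic.
Proof. by move=> t01; rewrite inE/= in_itv. Qed.

Definition unit0 (R : realType) : unit_interval R :=
  exist _ (0 : R) (mem_unit_interval (introT andP (conj (lexx 0) ler01))).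
Definition unit1 (R : realType) : unit_interval R :=
  exist _ (1 : R) (mem_unit_interval (introT andP (conj ler01 (lexx 1)))).

Lemma unit0_neq1 (R : realType) : unit0 R != unit1 R.
Proof. by apply/eqP => /(congr1 val)/= /esym/eqP; rewrite oner_eq0. Qed.

HB.instance Definition _ (R : realType) :=
  isBiPointed.Build (unit_interval R) (unit0_neq1 R).

Lemma node_subproof (R : realType) (r : nat) (j : 'I_r) :
  0 <= (j%:R / r.-1%:R : R) <= 1.
Proof.
rewrite divr_ge0//=; case: r j => [[]//|[|r]] j /=; first by rewrite invr0 mulr0.
by rewrite ler_pdivrMr ?ltr0n// mul1r ler_nat -ltnS ltn_ord.
Qed.

Definition node (R : realType) (r : nat) (j : 'I_r) : unit_interval R :=
  exist _ (j%:R / r.-1%:R : R) (mem_unit_interval (node_subproof R j)).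

(* PY, with the compact-open topology. *)
Definition path_space (R : realType) (Y : topologicalType) : Type :=
  continuousType (unit_interval R) Y.

HB.instance Definition _ (R : realType) (Y : topologicalType) :=
  Choice.on (path_space R Y).
HB.instance Definition _ (R : realType) (Y : topologicalType) :=
  Topological.copy (path_space R Y)
    (@initial_topology (path_space R Y) {compact-open, unit_interval R -> Y}
       (fun g => g : unit_interval R -> Y)).

(* The empty space is not path-connected: were it allowed, cat of the map from
   the empty space to itself would be +oo whereas its TC_r would be 0. *)
Definition path_connected (R : realType) (Y : topologicalType) : Prop :=
  inhabited Y /\
  forall x y : Y, inhabited {path (unit_interval R) from x to y}.

(* f^n, between powers carrying the product topology. *)
Definition power_map (X Y : Type) (n : nat) (f : X -> Y)
    (x : {ptws 'I_n -> X}) : {ptws 'I_n -> Y} :=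
  fun i => f (x i).

(* The values N u {oo} of TC_r and cat are embedded in \bar R. *)
Definition least (R : realType) (P : nat -> Prop) : \bar R :=
  match pselect (exists k, `[< P k >]) with
  | left exP => (ex_minn exP)%:R%:E
  | right _ => +oo%E
  end.

Definition open_cover_by (A : topologicalType) (P : set A -> Prop) (k : nat)
    : Prop :=
  exists U : 'I_k.+1 -> set A,
    (forall i, open (U i) /\ P (U i)) /\ \bigcup_i U i = [set: A].

Definition has_motion_planner (R : realType) (X Y : topologicalType)
    (f : X -> Y) (r : nat) (Z : set {ptws 'I_r -> X}) : Prop :=
  exists s : Z -> path_space R Y, continuous s /\
    forall (x : Z) (j : 'I_r),
      (s x : unit_interval R -> Y) (node R j) = f (set_val x j).

Definition TC_map (R : realType) (X Y : topologicalType) (r : nat)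
    (f : X -> Y) : \bar R :=
  least R (open_cover_by (@has_motion_planner R X Y f r)).

Definition TC (R : realType) (r : nat) (X : topologicalType) : \bar R :=
  TC_map R r (@id X).

Definition nullhomotopic (R : realType) (A B : topologicalType) (h : A -> B)
    : Prop :=
  exists (b : B) (H : A * unit_interval R -> B),
    continuous H /\
    (forall a, H (a, zero) = h a) /\ (forall a, H (a, one) = b).

Definition LS_cat (R : realType) (A B : topologicalType) (h : A -> B)
    : \bar R :=
  least R (open_cover_by (fun U : set A => nullhomotopic R (sigL U h))).

(* Main.v *)
Require Import Defs.
From HB Require Import structures.
From mathcomp Require Import all_boot all_order all_algebra.
From mathcomp Require Import all_classical all_reals all_analysis homotopy.
From mathcomp Require Import lra.

(** Since the unit interval is compact Hausdorff, a continuous motion planner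
    with values in the path space is the same thing as one continuous map
    [G : Z * [0,1] -> Y] with [G (x, j/(r-1)) = f (x_j)]
    ([has_motion_plannerP]). All the inequalities become statements about such
    maps and about nullhomotopies, and each of them is obtained by pulling an
    open cover back along a continuous map ([open_cover_by_preimage]).

    A planner for [f] can be postcomposed with [g], and a planner for [g] can
    be precomposed with [f^r], so [TC_r(g o f)] is at most both [TC_r(f)] and
    [TC_r(g)]; writing [f] as [f o id] and as [id o f] gives part 1.

    For [cat(f^(r-1)) <= TC_r(f)], embed [X^(r-1)] in [X^r] by
    [x |-> (x0, x)]. The planned path for [(x0, x)] visits [f x0] and then all
    the [f (x_j)], so sliding each of the latter points back along the path to
    time 0 contracts [f^(r-1)] to the constant [f x0]
    ([LS_cat_le_TC_map]).

    For [TC_r(f) <= cat(f^r)], a nullhomotopy of [f^r] over [U] consists of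
    paths leaving the points [f (x_j)] and ending at points independent of
    [x]; as [Y] is path-connected, they can be prolonged to end at a common
    point [y0] ([homotopy_move_end]). The motion planner goes at time
    [j/(r-1)] through [f (x_j)], and between two consecutive nodes it follows
    one of these paths to [y0] and the next one backwards
    ([TC_map_le_LS_cat]). *)

Set Implicit Arguments.
Unset Strict Implicit.

Import Order.TTheory GRing.Theory Num.Theory.
Import numFieldNormedType.Exports.
Local Open Scope classical_set_scope.
Local Open Scope ring_scope.

(** * Continuity *)

(** The preimage of a closed set is the finite union of its traces on the
    pieces, each of which is closed by continuity of the local map. Asking for
    local maps that are defined and continuous everywhere avoids the subspace
    topologies. *)
Lemma closed_gluing (T Y : topologicalType) (I : finType) (A : I -> set T)
    (g : I -> T -> Y) :
  (forall i, closed (A i)) -> (forall x, exists i, A i x) ->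
  (forall i, continuous (g i)) ->
  (forall i j x, A i x -> A j x -> g i x = g j x) ->
  exists h : T -> Y, continuous h /\ forall i x, A i x -> h x = g i x.
Proof.
move=> clA /choice[k Ak] ctsg gE; exists (fun x => g (k x) x).
have hE i x : A i x -> g (k x) x = g i x by move=> Aix; exact: gE.
split=> //; apply/continuous_closedP => C clC.
have -> : (fun x => g (k x) x) @^-1` C =
    \bigcup_(i in [set: I]) (A i `&` g i @^-1` C).
  apply/seteqP; split=> x /=; first by move=> Cx; exists (k x).
  by case=> i _ [Aix Cgx]; rewrite /= (hE i).
apply: closed_bigcup => [|i _]; first exact: finite_finset.
by apply: closedI => //; exact: (continuous_closedP _).1.
Qed.

Lemma continuous_pair (T X Y : topologicalType) (g : T -> X) (h : T -> Y) :
  continuous g -> continuous h -> continuous (fun x => (g x, h x)).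
Proof. by move=> cg ch x; apply: cvg_pair; [exact: cg|exact: ch]. Qed.

Lemma continuous_compose (X Y Z : topologicalType) (f : X -> Y) (g : Y -> Z) :
  continuous f -> continuous g -> continuous (g \o f).
Proof. by move=> ctsf ctsg x; exact: (continuous_comp (ctsf x) (ctsg _)). Qed.

Lemma fst_continuous (X Y : topologicalType) : continuous (@fst X Y).
Proof. by move=> z; exact: cvg_fst. Qed.

Lemma snd_continuous (X Y : topologicalType) : continuous (@snd X Y).
Proof. by move=> z; exact: cvg_snd. Qed.

Lemma continuous_ptws (T Y : topologicalType) (n : nat)
    (g : T -> {ptws 'I_n -> Y}) :
  (forall i, continuous (fun x => g x i)) -> continuous g.
Proof.
move=> ctsg x; apply/cvg_sup => i.
exact: (@continuous_comp_initial _ _ _ (fun f : 'I_n -> Y => f i) g (ctsg i)).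
Qed.

Lemma continuous_coord (T Y : topologicalType) (n : nat)
    (g : T -> {ptws 'I_n -> Y}) (i : 'I_n) :
  continuous g -> continuous (fun x => g x i).
Proof.
move=> ctsg.
apply: (@continuous_compose _ {ptws 'I_n -> Y} _ g (@proj _ (fun=> Y) i)) => //.
exact: (@proj_continuous _ (fun=> Y) i).
Qed.

Lemma power_map_continuous (X Y : topologicalType) (n : nat) (f : X -> Y) :
  continuous f -> continuous (@power_map X Y n f).
Proof.
move=> ctsf; apply: continuous_ptws => i x.
have ctsi := @proj_continuous 'I_n (fun=> X) i x.
exact: (continuous_comp ctsi (ctsf _)).
Qed.

Section preimage_restriction.
Context {A B : topologicalType} (g : A -> B) (U : set B).

Definition preimage_restr (x : g @^-1` U) : U :=
  exist _ (g (set_val x)) (mem_set (set_valP x)).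

Lemma preimage_restr_continuous : continuous g -> continuous preimage_restr.
Proof.
move=> ctsg; apply: continuous_comp_initial.
by apply: (@continuous_compose _ _ _ set_val g) => //; exact: initial_continuous.
Qed.

End preimage_restriction.
Arguments preimage_restr {A B} g U x.

(** * The unit interval and the path space *)

Section unit_interval_theory.
Context {R : realType}.
Notation I := (unit_interval R).

Lemma clamp_subproof (x : R) : 0 <= Num.max 0 (Num.min 1 x) <= 1.
Proof. by rewrite le_max lexx/= ge_max ler01/= ge_min lexx. Qed.

(** The retraction of the line onto [0, 1]: it turns any real formula into a
    point of the interval, so that reparametrizations of paths can be written
    without carrying membership proofs. *)
Definition clamp (x : R) : I :=
  exist _ (Num.max 0 (Num.min 1 x))
    (mem_unit_interval (clamp_subproof x)).

Lemma unit_valP (t : I) : 0 <= val t <= 1.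
Proof. by have := set_valP t; rewrite /= in_itv. Qed.

Lemma clampE (x : R) (t : I) : x = val t -> clamp x = t.
Proof.
move=> ->; apply: val_inj => /=; have /andP[t0 t1] := unit_valP t.
by rewrite min_r// max_r.
Qed.

Lemma unit_val_continuous : continuous (val : I -> R).
Proof. exact: initial_continuous. Qed.

Lemma clamp_continuous : continuous clamp.
Proof.
apply: continuous_comp_initial => x.
have cmin : {for x, continuous (cst 1 \min id : R -> R^o)}.
  by apply: continuous_min; [exact: cvg_cst|exact: cvg_id].
have cmax : {for x, continuous (cst 0 \max (cst 1 \min id) : R -> R^o)}.
  by apply: continuous_max; [exact: cvg_cst|exact: cmin].
exact: cmax.
Qed.

Lemma unit_compact : compact [set: I].
Proof.
have -> : [set: I] = clamp @` `[0, 1].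
  apply/seteqP; split=> // t _; exists (val t); last exact: clampE.
  exact: set_valP.
apply: continuous_compact (@segment_compact R 0 1).
exact/continuous_subspaceT/clamp_continuous.
Qed.

Lemma unit_hausdorff : hausdorff_space I.
Proof.
move=> s t st; apply/val_inj/Rhausdorff => A B As Bt.
have [u [Au Bu]] := st _ _ (unit_val_continuous As) (unit_val_continuous Bt).
by exists (val u).
Qed.

Lemma unit_locally_compact : locally_compact [set: I].
Proof.
move=> t _; exists setT; first exact: filterT.
by split; [exact: unit_compact|exact: closedT].
Qed.

Lemma snd_val_continuous (T : topologicalType) :
  continuous (fun z : T * I => val z.2).
Proof. exact: continuous_compose (@snd_continuous T I) unit_val_continuous. Qed.

Lemma reparam_continuous (T S : topologicalType) (k : T -> S) (h : R -> R) :
  continuous k -> continuous h ->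
  continuous (fun z : T * I => (k z.1, clamp (h (val z.2)))).
Proof.
move=> ctsk ctsh; apply: continuous_pair.
  exact: continuous_compose (@fst_continuous T I) ctsk.
have ctshv := continuous_compose (@snd_val_continuous T) ctsh.
exact: continuous_compose ctshv clamp_continuous.
Qed.

End unit_interval_theory.

Lemma path_space_curry (R : realType) (T Y : topologicalType)
    (G : T * unit_interval R -> Y) :
  continuous G -> exists s : T -> path_space R Y, continuous s /\
    forall x t, (s x : unit_interval R -> Y) t = G (x, t).
Proof.
move=> ctsG; have [cG cGx] := continuous_curry ctsG.
pose s x : path_space R Y :=
  HB.pack (curry G x) (isContinuous.Build _ _ (curry G x) (cGx x)).
exists s; split=> //; exact: continuous_comp_initial.
Qed.

(** Compactness of the interval enters here: evaluation is jointly continuous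
    for the compact-open topology only because the interval is locally compact
    Hausdorff. *)
Lemma path_space_uncurry (R : realType) (T Y : topologicalType)
    (s : T -> path_space R Y) :
  continuous s ->
  continuous (fun p : T * unit_interval R => (s p.1 : unit_interval R -> Y) p.2).
Proof.
move=> ctss; have -> : (fun p : T * unit_interval R =>
    (s p.1 : unit_interval R -> Y) p.2) =
    uncurry (fun x => s x : unit_interval R -> Y) by apply/funext => -[].
apply: continuous_uncurry.
- exact: unit_locally_compact.
- exact: unit_hausdorff.
- exact: (continuous_compose ctss (@initial_continuous _
    {compact-open, unit_interval R -> Y} (fun h : path_space R Y => h : _ -> _))).
- by move=> u; exact: cts_fun.
Qed.

Lemma has_motion_plannerP (R : realType) (X Y : topologicalType) (f : X -> Y)
    (r : nat) (Z : set {ptws 'I_r -> X}) :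
  has_motion_planner R f Z <-> exists G : Z * unit_interval R -> Y,
    continuous G /\
    forall (x : Z) (j : 'I_r), G (x, node R j) = f (set_val x j).
Proof.
split=> [[s [ctss snode]]|[G [ctsG Gnode]]].
  eexists; split; first exact: path_space_uncurry ctss.
  by move=> x j; exact: snode.
have [s [ctss sE]] := path_space_curry ctsG.
by exists s; split=> // x j; rewrite sE.
Qed.

(** * Comparing the invariants *)

Lemma least_le (R : realType) (P Q : nat -> Prop) :
  (forall k, Q k -> P k) -> (least R P <= least R Q)%E.
Proof.
move=> QP; rewrite /least; case: (pselect (exists k, `[< Q k >])) => [exQ|_];
  last by rewrite leey.
case: pselect => [exP|nexP].
  case: ex_minnP => m _ mP; case: ex_minnP => n /asboolP/QP Pn _.
  by rewrite lee_fin ler_nat mP//; exact/asboolP.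
by case: nexP; have [k /asboolP/QP Pk] := exQ; exists k; exact/asboolP.
Qed.

(** The case where [g] is the identity is also useful: it transfers a bound
    from one property of open sets to a weaker one. *)
Lemma open_cover_by_preimage (A B : topologicalType) (g : A -> B)
    (P : set B -> Prop) (Q : set A -> Prop) (k : nat) :
  continuous g -> (forall U, P U -> Q (g @^-1` U)) ->
  open_cover_by P k -> open_cover_by Q k.
Proof.
move=> ctsg PQ [U [oU covU]]; exists (fun i => g @^-1` U i); split.
  move=> i; have [oUi PUi] := oU i; split; last exact: PQ.
  by move/continuousP: ctsg; apply.
apply/seteqP; split=> // x _.
have [i _ Uigx] : (\bigcup_i U i) (g x) by rewrite covU.
by exists i.
Qed.

Lemma TC_map_comp_le_inner (R : realType) (r : nat) (X Y Z : topologicalType)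
    (f : X -> Y) (g : Y -> Z) :
  continuous g -> (TC_map R r (g \o f) <= TC_map R r f)%E.
Proof.
move=> ctsg; apply: least_le => k.
apply: (@open_cover_by_preimage _ _ id) => [x|U]; first exact: cvg_id.
move=> /has_motion_plannerP[G [ctsG Gnode]]; apply/has_motion_plannerP.
exists (g \o G); split=> [|x j]; last by rewrite /= Gnode.
exact: continuous_compose ctsG ctsg.
Qed.

Lemma TC_map_comp_le_outer (R : realType) (r : nat) (X Y Z : topologicalType)
    (f : X -> Y) (g : Y -> Z) :
  continuous f -> (TC_map R r (g \o f) <= TC_map R r g)%E.
Proof.
move=> ctsf; apply: least_le => k.
have ctsfr := @power_map_continuous X Y r f ctsf.
apply: (open_cover_by_preimage ctsfr) => U.
move=> /has_motion_plannerP[G [ctsG Gnode]]; apply/has_motion_plannerP.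
pose fU := preimage_restr (@power_map X Y r f) U.
exists (fun p => G (fU p.1, p.2)); split=> [|x j]; last by rewrite /= Gnode.
apply: continuous_compose ctsG; apply: continuous_pair (@snd_continuous _ _).
apply: continuous_compose (@fst_continuous _ _) _.
exact: preimage_restr_continuous.
Qed.

(** The point [x0] is prepended, so that the common target [f x0] of the
    contraction is the value of the planned path at time 0. *)
Lemma LS_cat_le_TC_map (R : realType) (n : nat) (X Y : topologicalType)
    (x0 : X) (f : X -> Y) :
  (LS_cat R (@power_map X Y n.+1 f) <= TC_map R n.+2 f)%E.
Proof.
pose incl (x : {ptws 'I_n.+1 -> X}) : {ptws 'I_n.+2 -> X} :=
  fun i => if unlift ord0 i is Some j then x j else x0.
have ctsincl : continuous incl.
  apply: continuous_ptws => i; rewrite /incl.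
  case: unlift => [j|]; last exact: (@cst_continuous _ _ x0).
  exact: (@proj_continuous _ (fun=> X) j).
apply: least_le => k; apply: (open_cover_by_preimage ctsincl) => U.
move=> /has_motion_plannerP[G [ctsG Gnode]].
(* The j-th coordinate runs along the planned path, at constant speed, from
   the node of x_j back to time 0. *)
pose h (j : 'I_n.+1) (u : R) : R := (1 - u) * val (node R (lift ord0 j)).
pose c j (t : unit_interval R) : unit_interval R := clamp (h j (val t)).
have ctsh j : continuous (h j).
  by move=> u; apply: cvgMl; apply: cvgB; [exact: cvg_cst|exact: cvg_id].
exists (fun=> f x0),
  (fun p => fun j => G (preimage_restr incl U p.1, c j p.2)).
split; [|split].
- apply: continuous_ptws => j; apply: continuous_compose ctsG.
  by apply: reparam_continuous (ctsh j); exact: preimage_restr_continuous.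
- move=> x; apply/funext => j.
  have -> : c j zero = node R (lift ord0 j).
    by apply: clampE; rewrite /h subr0 mul1r.
  rewrite Gnode /=; congr f.
  by transitivity (incl (set_val x) (lift ord0 j)); rewrite // /incl liftK.
- move=> x; apply/funext => j.
  have -> : c j one = node R (ord0 : 'I_n.+2).
    by apply: clampE; rewrite /h /= subrr !mul0r.
  rewrite Gnode /=; congr f.
  by transitivity (incl (set_val x) ord0); rewrite // /incl unlift_none.
Qed.

(** The end value [b] is the same for all [x], so one path from [b] to [y] can
    be run after all the paths of the homotopy at once. *)
Lemma homotopy_move_end (R : realType) (T Y : topologicalType)
    (H : T * unit_interval R -> Y) (b y : Y) :
  continuous H -> (forall x, H (x, one) = b) ->
  {path (unit_interval R) from b to y} ->
  exists K : T * unit_interval R -> Y, continuous K /\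
    (forall x, K (x, zero) = H (x, zero)) /\ (forall x, K (x, one) = y).
Proof.
move=> ctsH H1 p.
pose g (i : bool) (z : T * unit_interval R) : Y :=
  if i then H (z.1, clamp (2 * val z.2)) else p (clamp (2 * val z.2 - 1)).
pose A (i : bool) : set (T * unit_interval R) :=
  if i then [set z | val z.2 <= 2^-1] else [set z | 2^-1 <= val z.2].
have cts2 : continuous (fun u : R => 2 * u).
  by move=> u; apply: cvgMr; exact: cvg_id.
have cts21 : continuous (fun u : R => 2 * u - 1).
  by move=> u; apply: cvgB; [exact: cts2|exact: cvg_cst].
have [||||K [ctsK KE]] := @closed_gluing _ Y _ A g.
- case.
    apply: ((continuous_closedP _).1 (@snd_val_continuous R T)
      [set u | u <= 2^-1]).
    exact: closed_le.
  apply: ((continuous_closedP _).1 (@snd_val_continuous R T)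
      [set u | 2^-1 <= u]).
  exact: closed_ge.
- move=> z; have [z2|/ltW z2] := leP (val z.2) 2^-1; first by exists true.
  by exists false.
- case.
    apply: continuous_compose ctsH.
    by apply: (@reparam_continuous R T T id) cts2 => x; exact: cvg_id.
  have ctspc : continuous (fun z : T * unit_interval R => clamp (2 * val z.2 - 1)).
    exact: continuous_compose (continuous_compose (@snd_val_continuous R T) cts21)
      clamp_continuous.
  by apply: continuous_compose ctspc _; exact: cts_fun.
- have gE z : A true z -> A false z -> g true z = g false z.
    rewrite /A /g /= => z1 z2; have vz : val z.2 = 2^-1 by apply/le_anti/andP.
    have -> : clamp (2 * val z.2) = one by apply: clampE; rewrite vz divff.
    have -> : clamp (2 * val z.2 - 1) = zero.
      by apply: clampE; rewrite vz divff// subrr.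
    by rewrite H1 path_zero.
  by move=> [] [] z // *; [exact: gE|exact/esym/gE].
exists K; split=> //; split=> x.
  rewrite (KE true) /A /g /=; last by rewrite invr_ge0.
  by congr (H (_, _)); apply: clampE; rewrite mulr0.
rewrite (KE false) /A /g /=; last by rewrite invf_le1// ler1n.
have -> : clamp (2 * 1 - 1) = one :> unit_interval R by apply: clampE => /=; lra.
by rewrite path_one.
Qed.

(** On the window of radius [1/(2(r-1))] around the node [j/(r-1)] the motion
    planner walks along the j-th prolonged path [K j] of the nullhomotopy,
    backwards from [y0] before the node and forwards to [y0] after it. The
    windows are closed, cover the interval and meet only at their ends, where
    every piece takes the value [y0]: the pieces glue. *)
Lemma TC_map_le_LS_cat (R : realType) (n : nat) (X Y : topologicalType)
    (f : X -> Y) :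
  path_connected R Y ->
  (TC_map R n.+2 f <= LS_cat R (@power_map X Y n.+2 f))%E.
Proof.
move=> [[y0] pcY]; apply: least_le => k.
apply: (@open_cover_by_preimage _ _ id) => [x|U]; first exact: cvg_id.
move=> [b [H [ctsH [H0 H1]]]]; apply/has_motion_plannerP; rewrite preimage_id.
have /choice[K KP] : forall j : 'I_n.+2, exists K : U * unit_interval R -> Y,
    continuous K /\ (forall x, K (x, zero) = f (set_val x j)) /\
    (forall x, K (x, one) = y0).
  move=> j; have [p] := pcY (b j) y0.
  have [||K [ctsK [K0 K1]]] :=
    @homotopy_move_end _ _ _ (fun z => H z j) (b j) y0 _ _ p.
  - exact: continuous_coord.
  - by move=> x; rewrite H1.
  - by exists K; split=> //; split=> // x; rewrite K0 H0.
(* The distance from u to the j-th node, in units of the step between nodes. *)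
pose d (j : 'I_n.+2) (u : R) := `|n.+1%:R * u - j%:R|.
have ctsd j : continuous (d j).
  move=> u; apply: cvg_norm; apply: cvgB; last exact: cvg_cst.
  by apply: cvgMr; exact: cvg_id.
pose A j := [set z : U * unit_interval R | d j (val z.2) <= 2^-1].
pose g j (z : U * unit_interval R) := K j (z.1, clamp (2 * d j (val z.2))).
(* Two windows meet only at their common end, the nodes being a step apart. *)
have d_half i j u : i != j -> d i u <= 2^-1 -> d j u <= 2^-1 -> d i u = 2^-1.
  move=> ij di dj; apply/le_anti; rewrite di/=.
  have ij1 : 1 <= `|i%:R - j%:R : R|.
    move: ij; rewrite -val_eqE neq_ltn ler_normr => /orP[] ij;
      apply/orP; [right|left]; move: ij; rewrite -(ler_nat R) -natr1; lra.
  have : `|i%:R - j%:R : R| <= d i u + d j u.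
    rewrite /d (distrC _ i%:R); apply: le_trans (ler_normD _ _).
    by rewrite addrA subrK.
  lra.
have [||||G [ctsG GE]] := @closed_gluing _ Y _ A g.
- move=> j; have ctsdv := continuous_compose (@snd_val_continuous R U) (ctsd j).
  apply: ((continuous_closedP _).1 ctsdv [set u | u <= 2^-1]).
  exact: closed_le.
- move=> z; have /andP[v0 v1] := unit_valP z.2.
  set v := val z.2 in v0 v1 *.
  (* The nearest node is found by rounding (r - 1) * v to an integer. *)
  have w0 : 0 <= n.+1%:R * v + 2^-1 by rewrite addr_ge0// mulr_ge0.
  have /andP[] := truncn_itv w0; set m := Num.truncn _ => m1 m2.
  have mn : (m < n.+2)%N.
    rewrite /m truncn_lt_nat// -(natr1 n.+1).
    have : n.+1%:R * v <= n.+1%:R by rewrite ler_piMr.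
    lra.
  exists (Ordinal mn); rewrite -(natr1 m) in m2.
  change (`|n.+1%:R * v - m%:R| <= 2^-1).
  by rewrite ler_norml; apply/andP; split; lra.
- move=> j; have [ctsK _] := KP j; apply: continuous_compose ctsK.
  apply: (@reparam_continuous R U U id (fun u => 2 * d j u)) => u.
    exact: cvg_id.
  by apply: cvgMr; exact: ctsd.
- move=> i j z Ai Aj; have [->//|ij] := eqVneq i j.
  have -> : g i z = y0.
    rewrite /g (d_half i j)//.
    by rewrite (_ : clamp _ = one) ?(KP i).2.2//; apply: clampE; rewrite divff.
  rewrite /g (d_half j i)//; last by rewrite eq_sym.
  by rewrite (_ : clamp _ = one) ?(KP j).2.2//; apply: clampE; rewrite divff.
exists G; split=> // x j; have [_ [K0 _]] := KP j.
have dj : d j (val (node R j)) = 0.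
  by rewrite /d /= mulrCA divff ?mulr1 ?subrr ?normr0// pnatr_eq0.
rewrite (GE j); last by rewrite /A /= dj invr_ge0.
by rewrite /g dj mulr0 (_ : clamp 0 = zero) ?K0//; exact: clampE.
Qed.

Unset Implicit Arguments.
Set Strict Implicit.
Local Open Scope ereal_scope.

Theorem proposition3p3 (R : realType) (r : nat) (hr : (2 <= r)%N)
    (X Y : topologicalType) (hX : path_connected R X) (hY : path_connected R Y)
    (f : X -> Y) (hf : continuous f) :
  TC_map R r f <= Order.min (TC R r X) (TC R r Y) /\
  (LS_cat R (@power_map X Y r.-1 f) <= TC_map R r f /\
   TC_map R r f <= LS_cat R (@power_map X Y r f)).
Proof.
case: r hr => [|[|n]]// _; split; last split.
- rewrite le_min; apply/andP; split.
    exact: (@TC_map_comp_le_inner R n.+2 X X Y id f).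
  exact: (@TC_map_comp_le_outer R n.+2 X Y Y f id).
- by have [[x0] _] := hX; exact: LS_cat_le_TC_map.
- exact: TC_map_le_LS_cat.
Qed.
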